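(* Let $\mathcal A$ and $\mathcal B$ be clones on sets $A$ and $B$, and let $n\in\mathbb N$. If $\mathcal O_{A,B}^{(n+1)}$ is uniformly generated by $n$-ary $(\mathcal A,\mathcal B)$-minors, then $\mathcal C=\langle\mathcal C^{(n)}\rangle_{\mathcal A,\mathcal B}$ for every $(\mathcal A,\mathcal B)$-clonoid $\mathcal C$.
   Context: $\mathbb N=\{1,2,\dots\}$. For sets $A,B$, $\mathcal O_{A,B}=\bigcup_{m\ge 1}B^{A^m}$; for $\mathcal C\subseteq\mathcal O_{A,B}$, $\mathcal C^{(m)}=\mathcal C\cap B^{A^m}$. A clone on $A$ is a set of finitary operations on $A$ containing all projections and closed under composition. An $(\mathcal A,\mathcal B)$-clonoid is a set $\mathcal C\subseteq\mathcal O_{A,B}$ such that for all $m,p\in\mathbb N$: (i) $f_1,\dots,f_p\in\mathcal C^{(m)}$, $g\in\mathcal B^{(p)}$ imply $g\circ(f_1,\dots,f_p)\in\mathcal C^{(m)}$; (ii) $f\in\mathcal C^{(m)}$, $g_1,\dots,g_m\in\mathcal A^{(p)}$ imply $f\circ(g_1,\dots,g_m)\in\mathcal C^{(p)}$. $\langle G\rangle_{\mathcal A,\mathcal B}$ is the smallest $(\mathcal A,\mathcal B)$-clonoid containing $G\subseteq\mathcal O_{A,B}$. $R_n^{k,l}(\mathcal A)$ is the set of maps $r\colon A^k\to A^l$ of the form $r=v\circ w$ with $w\in(\mathcal A^{(k)})^n$ and $v\in(\mathcal A^{(n)})^l$. A set $U\subseteq B^{A^k}$ is uniformly generated by $n$-ary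 $(\mathcal A,\mathcal B)$-minors if there are $m\in\mathbb N$, $s\in\mathcal B^{(m)}$ and $r_1,\dots,r_m\in R_n^{k,k}(\mathcal A)$ such that $f=s\circ(f\circ r_1,\dots,f\circ r_m)$ for every $f\in U$. *)

(* Defs.v *)
From mathcomp Require Import all_boot.
From mathcomp Require Import boolp classical_sets.

Set Implicit Arguments.
Unset Strict Implicit.
Unset Printing Implicit Defensive.

Local Open Scope classical_set_scope.

(* A point of A^m is a map 'I_m -> A, so [op A B m] is B^(A^m). *)
Definition op (A B : Type) (m : nat) : Type := ('I_m -> A) -> B.

(* O_{A,B}, as a disjoint union over the arities m >= 1. *)
Record finop (A B : Type) : Type := Finop {
  arity : nat;
  arity_gt0 : 0 < arity;
  opval : op A B arity }.

(* C^(m), as a set of maps A^m -> B; it is empty for m = 0. *)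
Definition part (A B : Type) (C : set (finop A B)) (m : nat) : set (op A B m) :=
  [set f | exists m_gt0 : 0 < m, C (Finop m_gt0 f)].

(* C^(m), as a subset of O_{A,B}. *)
Definition arity_part (A B : Type) (C : set (finop A B)) (m : nat) :
    set (finop A B) :=
  C `&` [set F | arity F = m].

Definition proj (A : Type) (m : nat) (i : 'I_m) : op A A m := fun x => x i.

Definition tupled (A B : Type) (k l : nat) (g : 'I_l -> op A B k) :
    ('I_k -> A) -> ('I_l -> B) :=
  fun x i => g i x.

Definition opcomp (A B D : Type) (p m : nat) (g : op B D p)
    (f : 'I_p -> op A B m) : op A D m :=
  g \o tupled f.

(* The arities are positive in all the closure conditions below, because
   [part C 0] is empty. *)
Definition is_clone (A : Type) (C : set (finop A A)) : Prop :=
  (forall (m : nat) (i : 'I_m), part C (@proj A m i)) /\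
  (forall (m p : nat) (f : op A A m) (g : 'I_m -> op A A p),
     part C f -> (forall i, part C (g i)) -> part C (opcomp f g)).

Definition is_clonoid (A B : Type) (CA : set (finop A A)) (CB : set (finop B B))
    (C : set (finop A B)) : Prop :=
  (forall (m p : nat) (f : 'I_p -> op A B m) (g : op B B p),
     (forall i, part C (f i)) -> part CB g -> part C (opcomp g f)) /\
  (forall (m p : nat) (f : op A B m) (g : 'I_m -> op A A p),
     part C f -> (forall i, part CA (g i)) -> part C (opcomp f g)).

Definition clonoid_gen (A B : Type) (CA : set (finop A A))
    (CB : set (finop B B)) (G : set (finop A B)) : set (finop A B) :=
  smallest (is_clonoid CA CB) G.

(* R_n^{k,l}(CA) *)
Definition Rmaps (A : Type) (CA : set (finop A A)) (n k l : nat) :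
    set (('I_k -> A) -> ('I_l -> A)) :=
  [set r | exists (w : 'I_n -> op A A k) (v : 'I_l -> op A A n),
     [/\ forall i, part CA (w i), forall j, part CA (v j)
       & r = tupled v \o tupled w]].

Definition uniformly_generated (A B : Type) (CA : set (finop A A))
    (CB : set (finop B B)) (n k : nat) (U : set (op A B k)) : Prop :=
  exists (m : nat) (s : op B B m) (r : 'I_m -> ('I_k -> A) -> ('I_k -> A)),
    [/\ part CB s, forall i, Rmaps CA n (r i)
      & forall f, U f -> f = opcomp s (fun i => f \o r i)].

(* Main.v *)
Require Import Defs.
From mathcomp Require Import all_boot.
From mathcomp Require Import boolp classical_sets.

Set Implicit Arguments.
Unset Strict Implicit.
Unset Printing Implicit Defensive.

Local Open Scope classical_set_scope.

(** If [f = s (f \o r_1, ..., f \o r_m)] for all [f] of arity [k], with [s] and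
the [r_i] independent of [f], then the identity may be applied to an operation
of arity [k + d] with its last [d] arguments frozen.  Hence if the operations of
arity [n.+1] are uniformly generated by [n]-ary minors, then those of arity
[(n + d).+1] are uniformly generated by [(n + d)]-ary minors, so that a clonoid
descends from arity [n + d] to arity [n].  The operations of an arbitrary arity
[k] are first moved to arity [n + k] by adding dummy arguments. *)

Section Parts.

Variables (A B : Type).
Implicit Types (C D : set (finop A B)) (m k : nat).

Lemma partE C m (m_gt0 : 0 < m) (f : op A B m) :
  part C f = C (Finop m_gt0 f).
Proof.
apply/propext; split=> [[gt0 Cf] | Cf]; last by exists m_gt0.
by rewrite (bool_irrelevance m_gt0 gt0).
Qed.

Lemma partT m : 0 < m -> part [set: finop A B] (m := m) = setT.
Proof. by move=> m_gt0; apply/seteqP; split=> // f _; exists m_gt0. Qed.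

Lemma arity_part_subP C D k :
  arity_part C k `<=` D <-> part C (m := k) `<=` part D (m := k).
Proof.
split=> [CD f [k_gt0 Cf] | CD [m m_gt0 f] [/= Cf mk]].
  by exists k_gt0; apply: CD.
by subst m; rewrite -partE; apply: CD; exists m_gt0.
Qed.

End Parts.

Definition arg_cat (A : Type) (k d : nat) (x : 'I_k -> A) (y : 'I_d -> A) :
    'I_(k + d) -> A :=
  fun i => match split i with inl a => x a | inr b => y b end.

Definition pad_map (A : Type) (k l d : nat) (r : ('I_k -> A) -> ('I_l -> A)) :
    ('I_(k + d) -> A) -> ('I_(l + d) -> A) :=
  fun x => arg_cat (r (x \o lshift d)) (x \o @rshift k d).

Arguments pad_map {A k l} d r.

Definition pad_ops (A : Type) (k l d : nat) (g : 'I_l -> op A A k) :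
    'I_(l + d) -> op A A (k + d) :=
  arg_cat (fun a => opcomp (g a) (fun j => proj (lshift d j)))
          (fun b => proj (rshift k b)).

Arguments pad_ops {A k l} d g.

Section Padding.

Variable A : Type.
Implicit Types n k l p d : nat.

Lemma arg_cat_lshift k d (x : 'I_k -> A) (y : 'I_d -> A) :
  arg_cat x y \o lshift d = x.
Proof.
by apply/funext=> a; rewrite /arg_cat /= -/(unsplit (inl a)) unsplitK.
Qed.

Lemma arg_cat_rshift k d (x : 'I_k -> A) (y : 'I_d -> A) :
  arg_cat x y \o @rshift k d = y.
Proof.
by apply/funext=> b; rewrite /arg_cat /= -/(unsplit (inr b)) unsplitK.
Qed.

Lemma arg_catK k d (x : 'I_(k + d) -> A) :
  arg_cat (x \o lshift d) (x \o @rshift k d) = x.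
Proof.
by apply/funext=> i; rewrite /arg_cat -[in RHS](splitK i); case: split.
Qed.

Lemma tupled_arg_cat (B : Type) k l d (g : 'I_l -> op A B k)
    (h : 'I_d -> op A B k) (x : 'I_k -> A) :
  tupled (arg_cat g h) x = arg_cat (tupled g x) (tupled h x).
Proof. by apply/funext=> i; rewrite /tupled /arg_cat; case: split. Qed.

Lemma pad_map_comp k l p d (r : ('I_l -> A) -> ('I_p -> A))
    (q : ('I_k -> A) -> ('I_l -> A)) :
  pad_map d (r \o q) = pad_map d r \o pad_map d q.
Proof.
by apply/funext=> x; rewrite /pad_map /= arg_cat_lshift arg_cat_rshift.
Qed.

Lemma pad_map_tupled k l d (g : 'I_l -> op A A k) :
  pad_map d (tupled g) = tupled (pad_ops d g).
Proof. by apply/funext=> x; rewrite tupled_arg_cat. Qed.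

Variable CA : set (finop A A).
Hypothesis CA_clone : is_clone CA.

Lemma part_pad_ops k l d (g : 'I_l -> op A A k) :
  (forall i, part CA (g i)) -> forall i, part CA (pad_ops d g i).
Proof.
case: CA_clone => CA_proj CA_comp CAg i.
by rewrite /pad_ops /arg_cat; case: split => [a|b] //; apply: CA_comp.
Qed.

Lemma Rmaps_pad n k l d (r : ('I_k -> A) -> ('I_l -> A)) :
  Rmaps CA n r -> Rmaps CA (n + d) (pad_map d r).
Proof.
move=> [w [v [CAw CAv ->]]]; exists (pad_ops d w), (pad_ops d v).
split; [exact: part_pad_ops | exact: part_pad_ops |].
by rewrite pad_map_comp !pad_map_tupled.
Qed.

End Padding.

Section UniformGeneration.

Variables (A B : Type) (CA : set (finop A A)) (CB : set (finop B B)).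
Implicit Types n k d : nat.

Lemma uniformly_generatedS n k (U V : set (op A B k)) :
  U `<=` V -> uniformly_generated CA CB n V -> uniformly_generated CA CB n U.
Proof.
move=> UV [m [s [r [CBs Rr fE]]]]; exists m, s, r.
by split=> // f /UV; apply: fE.
Qed.

Lemma uniformly_generated_pad n k d (U : set (op A B k)) :
  is_clone CA -> uniformly_generated CA CB n U ->
  uniformly_generated CA CB (n + d)
    [set f : op A B (k + d) | forall y, U (fun x => f (arg_cat x y))].
Proof.
move=> CA_clone [m [s [r [CBs Rr fE]]]].
exists m, s, (fun i => pad_map d (r i)).
split=> // [i | f Uf]; first exact: Rmaps_pad.
apply/funext=> x; rewrite -[in LHS](arg_catK x).
exact: (congr1 (@^~ (x \o lshift d)) (fE _ (Uf (x \o @rshift k d)))).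
Qed.

(* The minor [f \o id] suffices, because the identity of A^k factors through
   A^n by repeating an argument. *)
Lemma uniformly_generated_leq n k :
  is_clone CA -> is_clone CB -> 0 < k <= n ->
  uniformly_generated CA CB n [set: op A B k].
Proof.
move=> [CA_proj _] [CB_proj _]; case: k => // k /andP[_ le_kn].
exists 1, (proj ord0), (fun=> id); split=> // _.
exists (fun j => proj (inord j)), (fun i => proj (widen_ord le_kn i)).
split=> //; apply/funext=> x; apply/funext=> i.
by rewrite /tupled /proj /= inord_val.
Qed.

End UniformGeneration.

Section GeneratedClonoids.

Variables (A B : Type) (CA : set (finop A A)) (CB : set (finop B B)).
Implicit Types (C G H : set (finop A B)) (n k d : nat).

Lemma is_clonoid_gen G : is_clonoid CA CB (clonoid_gen CA CB G).
Proof.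
split=> [m p f g genf CBg | m p f g genf CAg].
- have [p_gt0 _] := CBg; have [m_gt0 _] := genf (Ordinal p_gt0).
  exists m_gt0 => D [D_clonoid GD]; rewrite -partE; apply: D_clonoid.1 => // i.
  by have [gt0 /(_ D (conj D_clonoid GD))] := genf i; exists gt0.
- have [m_gt0 f_in_gen] := genf; have [p_gt0 _] := CAg (Ordinal m_gt0).
  exists p_gt0 => D [D_clonoid GD]; rewrite -partE; apply: D_clonoid.2 => //.
  by rewrite partE; apply: f_in_gen.
Qed.

Lemma clonoid_gen_sub_trans G H :
  G `<=` clonoid_gen CA CB H -> clonoid_gen CA CB G `<=` clonoid_gen CA CB H.
Proof. by apply: smallest_sub; apply: is_clonoid_gen. Qed.

Lemma uniformly_generated_sub_gen C n k :
  is_clonoid CA CB C -> uniformly_generated CA CB n (part C (m := k)) ->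
  arity_part C k `<=` clonoid_gen CA CB (arity_part C n).
Proof.
move=> C_clonoid [m [s [r [CBs Rr fE]]]]; apply/arity_part_subP => f Cf.
set D := clonoid_gen CA CB (arity_part C n).
have D_clonoid : is_clonoid CA CB D by apply: is_clonoid_gen.
have CnD : part C (m := n) `<=` part D (m := n).
  by apply/arity_part_subP; apply: sub_gen_smallest.
rewrite (fE f Cf); apply: D_clonoid.1 => // i.
have [w [v [CAw CAv ->]]] := Rr i.
apply: (D_clonoid.2 _ _ (opcomp f v) w) => //.
by apply: CnD; apply: C_clonoid.2.
Qed.

Lemma arity_part_sub_gen_leq C n k :
  is_clone CA -> is_clone CB -> is_clonoid CA CB C -> k <= n ->
  arity_part C k `<=` clonoid_gen CA CB (arity_part C n).
Proof.
move=> CA_clone CB_clone C_clonoid le_kn F CF.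
have k_gt0 : 0 < k by rewrite -CF.2 arity_gt0.
apply: uniformly_generated_sub_gen CF => //.
apply: uniformly_generatedS (@subsetT _ _) _.
by apply: uniformly_generated_leq; rewrite // k_gt0.
Qed.

Lemma uniformly_generated_sub_gen_addn C n d :
  is_clone CA -> is_clonoid CA CB C ->
  uniformly_generated CA CB n [set: op A B n.+1] ->
  arity_part C (n + d) `<=` clonoid_gen CA CB (arity_part C n).
Proof.
move=> CA_clone C_clonoid ug.
elim: d => [|d IHd]; first by rewrite addn0; apply: sub_gen_smallest.
rewrite addnS -addSn; apply: subset_trans (clonoid_gen_sub_trans IHd).
apply: uniformly_generated_sub_gen => //.
by apply: uniformly_generatedS (uniformly_generated_pad d CA_clone ug).
Qed.

End GeneratedClonoids.

Theorem corollary20 (A B : Type) (CA : set (finop A A)) (CB : set (finop B B))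
    (n : nat) (CA_clone : is_clone CA) (CB_clone : is_clone CB)
    (n_gt0 : 0 < n)
    (ug : uniformly_generated CA CB n (part [set: finop A B] (m := n.+1))) :
  forall C : set (finop A B), is_clonoid CA CB C ->
    C = clonoid_gen CA CB (arity_part C n).
Proof.
move=> C C_clonoid; apply/seteqP; split; last first.
  by apply: smallest_sub => //; apply: subIsetl.
rewrite partT // in ug.
have gen_leq := arity_part_sub_gen_leq CA_clone CB_clone C_clonoid.
have gen_addn d :=
  uniformly_generated_sub_gen_addn (d := d) CA_clone C_clonoid ug.
move=> F CF; apply: (clonoid_gen_sub_trans (gen_addn (arity F))).
exact: gen_leq (leq_addl n (arity F)) F (conj CF erefl).
Qed.
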